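(* Let $\mathcal{S}$ be a unipotent numerical monoid in $G$. An element $\mathcal{T}$ of $Rel_T(\mathcal{S},\subseteq)$ is an idempotent (i.e. $\mathcal{T}\mathcal{T}=\mathcal{T}$) if and only if $\mathcal{T}$ is a unipotent numerical monoid in $G$. Furthermore, if $\mathcal{S}$ is commutative, then the idempotents of $Rel_T(\mathcal{S},\subseteq)$ form a band (i.e. the set of idempotents is closed under the product, hence is a semigroup all of whose elements are idempotents).
   Context: Setting: $n$ is a positive integer, $\mathbf{U}(n,\mathbb{C})$ is the group of upper triangular unipotent $n\times n$ complex matrices, and $G$ is a (Zariski) closed subgroup of it. $G_{\mathbb{Z}}$ is the group of matrices in $G$ with integer entries, and $G(\mathbb{N})$ is the monoid of matrices in $G_{\mathbb{Z}}$ all of whose entries lie in $\mathbb{N}=\{0,1,2,\dots\}$. Standing assumptions: the monoid $G(\mathbb{N})$ is finitely generated and $G_{\mathbb{Z}}$ is its group completion. $\mathbf{1}_n$ is the identity matrix. A unipotent numerical monoid in $G$ is a finitely generated submonoid $\mathcal{S}\subseteq G(\mathbb{N})$ (containing $\mathbf{1}_n$) such that $G(\mathbb{N})\setminus\mathcal{S}$ is finite. For subsets, $\mathcal{I}\mathcal{J}:=\{AB\mid A\in\mathcal{I},\,B\in\mathcal{J}\}$. A (two-sided) relative ideal of $\mathcal{S}$ is a subset $\mathcal{I}\subseteq G(\mathbb{N})$ with $\mathcal{I}\mathcal{S}\subseteq\mathcal{I}$ and $\mathcal{S}\mathcal{I}\subseteq\mathcal{I}$. $Rel_T(\mathcal{S})$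 is the monoid of all relative ideals of $\mathcal{S}$ under $(\mathcal{I},\mathcal{J})\mapsto\mathcal{I}\mathcal{J}$, and $Rel_T(\mathcal{S},\subseteq)$ (the torsion monoid) is the submonoid of those relative ideals $\mathcal{I}$ with $\mathcal{S}\subseteq\mathcal{I}$. *)

(* Defs.v *)
From mathcomp Require Import all_boot all_order all_algebra.
From mathcomp Require Import complex.
From mathcomp Require Import boolp classical_sets functions cardinality reals.
(* Not imported: the notations of mpoly clash with those of mathcomp-analysis. *)
From mathcomp Require mpoly.

Set Implicit Arguments.
Unset Strict Implicit.
Unset Printing Implicit Defensive.

Import GRing.Theory Num.Theory.

Local Open Scope classical_set_scope.
Local Open Scope ring_scope.

Section UnipotentNumericalMonoids.
Variables (R : realType) (n : nat).

Local Notation C := R[i].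
Local Notation M := 'M[C]_n.

(* Common zero locus of a family of polynomials in the n * n matrix entries. *)
Definition zariski_closed (V : set M) : Prop :=
  exists P : set (mpoly.mpoly (n * n) C),
    V = [set A | forall p, P p -> mpoly.meval (fun k => mxvec A 0 k) p = 0].

Definition unipotent_upper : set M :=
  [set A | (forall i j : 'I_n, (j < i)%N -> A i j = 0) /\
           (forall i, A i i = 1)].

Definition is_submonoid (S : set M) : Prop :=
  S 1%:M /\ (forall A B, S A -> S B -> S (A *m B)).

Definition is_subgroup (G : set M) : Prop :=
  [/\ G `<=` [set A | A \in unitmx], is_submonoid G
    & forall A, G A -> G (invmx A)].

Definition closed_unipotent_group (G : set M) : Prop :=
  [/\ G `<=` unipotent_upper, is_subgroup G & zariski_closed G].

Definition integer_points (G : set M) : set M :=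
  [set A | G A /\ forall i j, exists z : int, A i j = z%:~R].

Definition natural_points (G : set M) : set M :=
  [set A | integer_points G A /\ forall i j, exists k : nat, A i j = k%:R].

Definition fg_submonoid (S : set M) : Prop :=
  is_submonoid S /\
  exists F : set M, finite_set F /\ S = smallest is_submonoid F.

(* Homomorphisms defined on a submonoid are represented by total functions
   of which only the values on that submonoid matter. *)
Definition monoid_hom (S : set M) (H : groupType) (f : M -> H) : Prop :=
  f 1%:M = 1%g /\
  (forall A B, S A -> S B -> f (A *m B) = (f A * f B)%g).

(* Universal property: every homomorphism from S to a group extends uniquely
   to K. *)
Definition is_group_completion (S K : set M) : Prop :=
  [/\ is_submonoid S, is_subgroup K, S `<=` K
    & forall (H : groupType) (f : M -> H), monoid_hom S f ->
        (exists g : M -> H, monoid_hom K g /\ {in S, g =1 f}) /\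
        (forall g1 g2 : M -> H, monoid_hom K g1 -> monoid_hom K g2 ->
           {in S, g1 =1 f} -> {in S, g2 =1 f} -> {in K, g1 =1 g2})].

Definition unipotent_numerical_monoid (G S : set M) : Prop :=
  [/\ fg_submonoid S, S `<=` natural_points G
    & finite_set (natural_points G `\` S)].

Definition set_mulmx (I J : set M) : set M :=
  [set A *m B | A in I & B in J].

Definition relative_ideals (G S : set M) : set (set M) :=
  [set I | [/\ I `<=` natural_points G, set_mulmx I S `<=` I
             & set_mulmx S I `<=` I]].

Definition torsion_monoid (G S : set M) : set (set M) :=
  [set I | relative_ideals G S I /\ S `<=` I].

Definition commutative_set (S : set M) : Prop :=
  forall A B, S A -> S B -> comm_mx A B.

End UnipotentNumericalMonoids.

Definition idempotents (X : Type) (op : X -> X -> X) (E : set X) : set X :=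
  [set x | E x /\ op x x = x].

Definition is_band (X : Type) (op : X -> X -> X) (B : set X) : Prop :=
  [/\ forall x y, B x -> B y -> B (op x y),
      forall x y z, B x -> B y -> B z -> op x (op y z) = op (op x y) z
    & forall x, B x -> op x x = x].

(* Main.v *)
(** If S has finite complement in G(N), a relative ideal T containing S
differs from S by finitely many elements, which together with generators of S
generate T as soon as T is multiplicatively closed; conversely T contains the
identity matrix, so multiplicative closure gives TT = T.

For the band property it is enough that commutativity of S forces that of
G(N).  A natural unipotent matrix A <> 1 has an off-diagonal entry that
strictly increases along its powers, so the powers of A are pairwise distinct
and some consecutive powers A^k, A^(k+1) lie in S.  Whatever commutes with
both commutes with A, as A^k is invertible; using this once for each of two
elements of G(N) shows that they commute. *)
Require Import Defs.
From mathcomp Require Import all_boot all_order all_algebra.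
From mathcomp Require Import complex.
From mathcomp Require Import boolp classical_sets functions cardinality reals.

Import Order.TTheory GRing.Theory Num.Theory.

Local Open Scope classical_set_scope.
Local Open Scope ring_scope.

Section Products.
Variables (R : realType) (n : nat).
Local Notation M := 'M[R[i]]_n.
Implicit Types (G S T I J K : set M) (A B : M).

Lemma set_mulmxA I J K :
  set_mulmx I (set_mulmx J K) = set_mulmx (set_mulmx I J) K.
Proof.
apply/seteqP; split=> X.
  case=> A IA [_ [B JB [C KC <-]] <-]; exists (A *m B); first by exists A => //; exists B.
  by exists C => //; rewrite mulmxA.
case=> _ [A IA [B JB <-]] [C KC <-]; exists A => //.
by exists (B *m C); [exists B => //; exists C | rewrite mulmxA].
Qed.

Lemma set_mulmxS I I' J J' :
  I `<=` I' -> J `<=` J' -> set_mulmx I J `<=` set_mulmx I' J'.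
Proof. by move=> sI sJ _ [A IA [B JB <-]]; exists A; [exact: sI | exists B; [exact: sJ|]]. Qed.

Lemma set_mulmxC K I J : commutative_set K -> I `<=` K -> J `<=` K ->
  set_mulmx I J = set_mulmx J I.
Proof.
move=> cK sI sJ; apply/seteqP; split=> _ [A hA [B hB <-]];
  by exists B => //; exists A => //; apply: cK; auto.
Qed.

Lemma set_mulmx_idem T : is_submonoid T -> set_mulmx T T = T.
Proof.
move=> [T1 TM]; apply/seteqP; split=> [_ [A TA [B TB <-]]|A TA]; first exact: TM.
by exists A => //; exists 1%:M => //; rewrite mulmx1.
Qed.

Lemma idem_submonoid T : T 1%:M -> set_mulmx T T = T -> is_submonoid T.
Proof. by move=> T1 TT; split=> // A B TA TB; rewrite -TT; exists A => //; exists B. Qed.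

Lemma submonoid_exp S A k : is_submonoid S -> S A -> S (A ^+ k).
Proof.
move=> [S1 SM] SA; elim: k => [|k IHk]; first by rewrite expr0.
by rewrite exprS; apply: SM.
Qed.

Lemma fg_submonoid_finite_ext S T : fg_submonoid S -> is_submonoid T ->
  S `<=` T -> finite_set (T `\` S) -> fg_submonoid T.
Proof.
move=> [_ [F [finF defS]]] subT sST finTS; split=> //.
exists (F `|` (T `\` S)); split; first by rewrite finite_setU.
apply/seteqP; split=> A.
  move=> TA K [subK sK]; have [SA|nSA] := pselect (S A); last by apply: sK; right.
  by move: SA; rewrite defS; apply; split=> // B FB; apply: sK; left.
apply; split=> // B [FB|[]//]; apply: sST; rewrite defS => K [_]; exact.
Qed.

Lemma comm_mx_consecutive_powers A B k : A \in unitmx ->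
  comm_mx (A ^+ k) B -> comm_mx (A ^+ k.+1) B -> comm_mx A B.
Proof.
move=> uA cAk; rewrite /comm_mx exprSr => cAk1.
have uAk : A ^+ k \in unitmx.
  elim: k {cAk cAk1} => [|k IHk]; first by rewrite expr0 unitmx1.
  by rewrite exprS unitmx_mul uA.
(* After cancelling [A ^+ k] on the left, the claim is $A^k A B = B A^k A = A^k B A$: one use of
   each hypothesis. *)
apply: (can_inj (mulKmx uAk)).
by rewrite !mulmxA cAk1 cAk mulmxA.
Qed.

Lemma natural_ge0 G A i j : natural_points G A -> 0 <= A i j.
Proof. by move=> [_ /(_ i j) [k ->]]; apply: ler0n. Qed.

Lemma natural_unipotent_exp_inj G A : G `<=` @unipotent_upper R n ->
  is_submonoid (natural_points G) -> natural_points G A -> A != 1%:M ->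
  injective (fun k => A ^+ k).
Proof.
move=> sGU subN NA nA1.
have NAk k : natural_points G (A ^+ k) by apply: submonoid_exp.
have diag1 B i : natural_points G B -> B i i = 1 by move=> [[/sGU[_ ->]]].
have [i [j [nij Aij]]] : exists i j, j != i /\ 0 < A i j.
  apply: contrapT => noij; move/eqP: nA1; apply; apply/matrixP=> i j.
  rewrite mxE; have [<-|nij] := eqVneq i j; first exact: diag1.
  apply: contrapT => /eqP Aij0; apply: noij; exists i, j.
  by rewrite eq_sym nij lt_def Aij0 (natural_ge0 G).
(* In the sum for the [(i, j)] entry of $A^k A$, the index [i] contributes [A i j > 0], the index
   [j] contributes the old entry, and all other terms are nonnegative. *)
have incr k : (A ^+ k) i j < (A ^+ k.+1) i j.
  rewrite exprSr [ltRHS]mxE (bigD1 i) //= (bigD1 j) //= !diag1 // mul1r mulr1.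
  rewrite addrCA ltrDl ltr_wpDr //.
  by apply: sumr_ge0 => l _; apply: mulr_ge0; apply: (natural_ge0 G).
have mono : {homo (fun k => (A ^+ k) i j) : k l / (k < l)%N >-> k < l}.
  by apply: homo_ltn => //; exact: lt_trans.
move=> k l eqkl; have eqij : (A ^+ k) i j = (A ^+ l) i j := congr1 (fun B : M => B i j) eqkl.
by have [/mono|/mono|//] := ltngtP k l; rewrite eqij ltxx.
Qed.

(** By injectivity only finitely many exponents give a power outside [S]. If no two consecutive
    powers were in [S], every [k] would be such an exponent or the predecessor of one, making the
    set of naturals finite. *)
Lemma consecutive_powers_in S K A : finite_set (K `\` S) ->
  (forall k, K (A ^+ k)) -> injective (fun k => A ^+ k) ->
  exists k, S (A ^+ k) /\ S (A ^+ k.+1).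
Proof.
move=> finKS KA injA; apply: contrapT => noS; apply: infinite_nat.
pose p := fun k => A ^+ k.
apply: (@sub_finite_set _ _ (p @^-1` (K `\` S) `|` (p \o succn) @^-1` (K `\` S))).
  move=> k _; have [Sk|nSk] := pselect (S (A ^+ k)); last by left.
  by right; split; [exact: KA | move=> Sk1; apply: noS; exists k].
rewrite finite_setU; split; apply: finite_preimage => // k l _ _.
  exact: injA.
by move=> /injA [].
Qed.

Lemma natural_points_commutative G S : closed_unipotent_group G ->
  is_submonoid (natural_points G) -> unipotent_numerical_monoid G S ->
  commutative_set S -> commutative_set (natural_points G).
Proof.
move=> [sGU [sGunit _ _] _] subN [_ sSN finNS] cS.
have commN A B : natural_points G A -> (forall X, S X -> comm_mx X B) -> comm_mx A B.
  (* The identity is set apart because its powers are not distinct. *)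
  move=> NA cB; have [->|nA1] := eqVneq A 1%:M; first exact: comm1mx.
  have [k [Sk Sk1]] : exists k, S (A ^+ k) /\ S (A ^+ k.+1).
    apply: (consecutive_powers_in S _ A finNS).
      by move=> k; apply: submonoid_exp.
    exact: (natural_unipotent_exp_inj G).
  apply: (comm_mx_consecutive_powers A B k); [|exact: cB..].
  by apply: sGunit; case: NA => [[]].
(* The outer use of [commN] reduces [A] to elements [X] of [S]; the inner one, with [B] and [X] in
   the two roles, reduces [B] to elements of [S] as well. *)
move=> A B NA NB; apply: (commN) => // X SX; apply: comm_mx_sym.
by apply: commN => // Y SY; apply: cS.
Qed.

Lemma torsion_monoid_mul G S I J :
  is_submonoid (natural_points G) -> S 1%:M ->
  torsion_monoid G S I -> torsion_monoid G S J ->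
  torsion_monoid G S (set_mulmx I J).
Proof.
move=> [_ NM] S1 [[sIN IS SI] sSI] [[sJN JS SJ] sSJ]; split; first split.
- by move=> _ [A IA [B JB <-]]; apply: NM; [exact: sIN | exact: sJN].
- by rewrite -set_mulmxA; apply: set_mulmxS.
- by rewrite set_mulmxA; apply: set_mulmxS.
move=> A SA; exists A; first exact: sSI.
by exists 1%:M; [exact: sSJ | rewrite mulmx1].
Qed.

End Products.

Theorem theorem1p1 (R : realType) (n : nat) (n_gt0 : (0 < n)%N)
  (G : set 'M[R[i]]_n) (G_closed : closed_unipotent_group G)
  (GN_fg : fg_submonoid (natural_points G))
  (GZ_completion : is_group_completion (natural_points G) (integer_points G))
  (S : set 'M[R[i]]_n) (S_unm : unipotent_numerical_monoid G S) :
  (forall T : set 'M[R[i]]_n, torsion_monoid G S T ->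
     (set_mulmx T T = T <-> unipotent_numerical_monoid G T)) /\
  (commutative_set S ->
     is_band (@set_mulmx R n) (idempotents (@set_mulmx R n) (torsion_monoid G S))).
Proof.
have [subN _] := GN_fg; have [fgS sSN finNS] := S_unm.
have [[S1 _] _] := fgS.
split=> [T [[sTN _ _] sST]|cS].
  split=> [TT|[[subT _] _ _]]; last exact: set_mulmx_idem.
  split=> //.
    apply: (fg_submonoid_finite_ext _ _ S) => //.
      by apply: idem_submonoid => //; exact: sST.
    by apply: sub_finite_set finNS => A [/sTN].
  by apply: sub_finite_set finNS => A [NA nTA]; split=> // /sST.
have cN := natural_points_commutative _ _ G S G_closed subN S_unm cS.
split=> [I J [tI II] [tJ JJ]|I J K _ _ _|I [] //]; last exact: set_mulmxA.
split; first exact: torsion_monoid_mul.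
have [[[sIN _ _] _] [[sJN _ _] _]] := (tI, tJ).
(* $(IJ)(IJ) = I(JI)J = (II)(JJ) = IJ$. The ideals may leave [S], so the swap relies on
   commutativity of all of $G(\mathbb{N})$. *)
rewrite set_mulmxA -(set_mulmxA _ _ I J I).
by rewrite (set_mulmxC _ _ _ J I cN) // set_mulmxA II -set_mulmxA JJ.
Qed.
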